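(* Let $1\le k\le n$ and let $A$ be a generic real symmetric $n\times n$ matrix. The degree (number of complex critical points) of the multi-eigenvector problem $$\min/\max\ \operatorname{trace}(AP)\quad\text{subject to } P\in\mathrm{pGr}(k,n)$$ over the projection Grassmannian is $\binom{n}{k}$. The critical points are the $k$-dimensional subspaces spanned by $k$ eigenvectors of $A$ (each subspace being represented by the orthogonal projection matrix onto it).
   Context: The projection Grassmannian is the smooth affine variety $\mathrm{pGr}(k,n)=\{P\in\mathrm{Sym}(\mathbb{C}^n):P^2=P,\ \operatorname{trace}(P)=k\}$, where $\mathrm{Sym}(\mathbb{C}^n)$ is the space of complex symmetric $n\times n$ matrices; a $k$-dimensional subspace with a basis $Z\in\mathbb{C}^{n\times k}$, $Z^TZ=\mathrm{Id}_k$, is represented by $P=ZZ^T$. A critical point of a regular function $f$ on a smooth affine variety $W$ is a point $p\in W$ at which the differential of $f$ vanishes on the tangent space $T_pW$. ''Generic'' means: for all $A$ outside some proper Zariski closed subset of the space of symmetric matrices. *)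

(* Defs.v *)
From mathcomp Require Import all_boot all_order all_algebra.
From mathcomp Require Import classical_sets cardinality reals complex mpoly.

Set Implicit Arguments.
Unset Strict Implicit.
Unset Printing Implicit Defensive.

Import Order.TTheory GRing.Theory Num.Theory.
Local Open Scope ring_scope.
Local Open Scope classical_set_scope.

Section AlgebraicSets.
Variables (K : fieldType) (n : nat).

(* The coordinate ring of the affine space of n x n matrices is
   {mpoly K[n * n]}: the variable of index mxvec_index i j is the (i, j)
   entry. *)
Definition mx_eval (g : {mpoly K[n * n]}) (M : 'M[K]_n) : K :=
  g.@[fun i => mxvec M 0 i].

(* The differential of g at M, in the direction X. *)
Definition mx_diff (g : {mpoly K[n * n]}) (M X : 'M[K]_n) : K :=
  \sum_(i < n * n) mx_eval g^`M(i) M * mxvec X 0 i.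

Definition vanishing_ideal (W : set 'M[K]_n) : set {mpoly K[n * n]} :=
  [set g | forall M, W M -> mx_eval g M = 0].

(* The Zariski tangent space, as a subspace of the ambient matrix space. *)
Definition tangent_space (W : set 'M[K]_n) (M : 'M[K]_n) : set 'M[K]_n :=
  [set X | forall g, vanishing_ideal W g -> mx_diff g M X = 0].

(* f matters only through its restriction to W, which is regular when some
   polynomial F induces it.  Two such F differ by an element of the vanishing
   ideal, so their differentials agree on the tangent spaces of W. *)
Definition critical_points (W : set 'M[K]_n) (f : 'M[K]_n -> K) :
    set 'M[K]_n :=
  [set M | W M /\
    exists F : {mpoly K[n * n]},
      (forall N, W N -> mx_eval F N = f N) /\
      (forall X, tangent_space W M X -> mx_diff F M X = 0)].

Definition sym_mx : set 'M[K]_n := [set M | M^T = M].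

Definition zariski_closed_in (E Z : set 'M[K]_n) : Prop :=
  exists S : set {mpoly K[n * n]},
    Z = [set M | E M /\ forall g, S g -> mx_eval g M = 0].

Definition pGr (k : nat) : set 'M[K]_n :=
  [set P | [/\ sym_mx P, P *m P = P & \tr P = k%:R]].

Definition eigenvector (A : 'M[K]_n) (v : 'cV[K]_n) : Prop :=
  v != 0 /\ exists a : K, A *m v = a *: v.

Definition spanned_by_eigenvectors (k : nat) (A : 'M[K]_n)
    (L : {vspace 'cV[K]_n}) : Prop :=
  \dim L = k /\
  exists vs : k.-tuple 'cV[K]_n,
    (forall v, v \in vs -> eigenvector A v) /\ L = <<vs>>%VS.

(* P is the orthogonal projection onto L, for the bilinear form x^T y: the
   columns of Z are an orthonormal basis of L. *)
Definition represents (k : nat) (L : {vspace 'cV[K]_n}) (P : 'M[K]_n) : Prop :=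
  exists Z : 'M[K]_(n, k),
    [/\ Z^T *m Z = 1%:M, L = <<[seq col j Z | j <- enum 'I_k]>>%VS
      & P = Z *m Z^T].

End AlgebraicSets.

Definition holds_generically_sym (K : fieldType) (n : nat)
    (Q : 'M[K]_n -> Prop) : Prop :=
  exists Z : set 'M[K]_n,
    [/\ zariski_closed_in (@sym_mx K n) Z, Z `<` @sym_mx K n
      & forall A, sym_mx A -> ~ Z A -> Q A].

(* Main.v *)
Require Import Defs.
From mathcomp Require Import all_boot all_order all_algebra.
From mathcomp Require Import classical_sets cardinality reals complex mpoly.
From mathcomp Require Import ring separable.

(** The complex orthogonal group acts on the projection Grassmannian by
    conjugation, and the velocities of this action are tangent vectors: for a
    skew-symmetric S the matrix S P - P S is tangent at P.  As
    trace (A (S P - P S)) = trace ((P A - A P) S), a critical point P makes the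
    skew-symmetric matrix P A - A P orthogonal to all skew-symmetric matrices,
    so P commutes with A.  Conversely, differentiating P^2 = P shows that a
    tangent vector X satisfies X P + P X = X, hence P X P = 0, and then
    trace (A X) = 0 as soon as A and P commute.  So the critical points are the
    points of the Grassmannian that commute with A ([critical_pGrP]).

    The tangent space is the Zariski one: a velocity is tangent because every
    polynomial that vanishes along a curve has zero derivative along it
    ([curve_tangent]).  The curves are rational, so this is an identity between
    polynomials in the parameter, and it is obtained from first-order
    expansions with a rational remainder ([has_jet]), without any topology.

    When the characteristic polynomial of A is separable, the complex symmetric
    matrix A has an orthonormal eigenbasis for the bilinear form x^T y: the
    eigenvectors of distinct eigenvalues are orthogonal, the form is
    nondegenerate so none of them is isotropic, and square roots exist
    ([orthonormal_eigenbasis]).  In this basis a projection commuting with A is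
    diagonal with entries 0 and 1; such projections of trace k correspond to
    the k-element sets of basis vectors ([commuting_projP]), and there are
    'C(n, k) of them.

    Finally a symmetric projection is determined by its fixed space, which is
    the space that it represents ([represents_mem]); this gives the
    correspondence with the spaces spanned by eigenvectors.

    Separability is a generic condition because it follows from the
    nonvanishing of the determinant of p'(A), where p is the characteristic
    polynomial of A: this determinant is polynomial in the entries of A, and it
    is nonzero for the diagonal matrix with entries 0, ..., n - 1. *)

Set Implicit Arguments.
Unset Strict Implicit.
Unset Printing Implicit Defensive.

Import Order.TTheory GRing.Theory Num.Theory.
Local Open Scope ring_scope.

(** * Polynomials in the entries of a matrix and their differentials *)

Section Diff.
Variables (K : fieldType) (n : nat).
Implicit Types (g h : {mpoly K[n * n]}) (M X : 'M[K]_n).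

Lemma mx_evalD g h M : mx_eval (g + h) M = mx_eval g M + mx_eval h M.
Proof. exact: mevalD. Qed.

Lemma mx_evalB g h M : mx_eval (g - h) M = mx_eval g M - mx_eval h M.
Proof. exact: mevalB. Qed.

Lemma mx_evalM g h M : mx_eval (g * h) M = mx_eval g M * mx_eval h M.
Proof. exact: mevalM. Qed.

Lemma mx_eval_sum (I : Type) (r : seq I) (P : pred I)
    (G : I -> {mpoly K[n * n]}) M :
  mx_eval (\sum_(i <- r | P i) G i) M = \sum_(i <- r | P i) mx_eval (G i) M.
Proof. exact: raddf_sum. Qed.

Lemma mx_diffD g h M X : mx_diff (g + h) M X = mx_diff g M X + mx_diff h M X.
Proof.
rewrite /mx_diff -big_split; apply: eq_bigr => i _ /=.
by rewrite mderivD mx_evalD mulrDl.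
Qed.

Lemma mx_diffZ c g M X : mx_diff (c *: g) M X = c * mx_diff g M X.
Proof.
rewrite /mx_diff mulr_sumr; apply: eq_bigr => i _ /=.
by rewrite mderivZ /mx_eval mevalZ mulrA.
Qed.

Lemma mx_diff0 M X : mx_diff (0 : {mpoly K[n * n]}) M X = 0.
Proof. by rewrite -(scale0r 0) mx_diffZ mul0r. Qed.

Lemma mx_diffB g h M X : mx_diff (g - h) M X = mx_diff g M X - mx_diff h M X.
Proof. by rewrite mx_diffD -scaleN1r mx_diffZ mulN1r. Qed.

Lemma mx_diff_sum (I : Type) (r : seq I) (P : pred I)
    (G : I -> {mpoly K[n * n]}) M X :
  mx_diff (\sum_(i <- r | P i) G i) M X = \sum_(i <- r | P i) mx_diff (G i) M X.
Proof.
apply: (big_morph (fun g => mx_diff g M X)) => [g h|]; first exact: mx_diffD.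
exact: mx_diff0.
Qed.

Lemma mx_diffM g h M X :
  mx_diff (g * h) M X =
  mx_diff g M X * mx_eval h M + mx_eval g M * mx_diff h M X.
Proof.
rewrite /mx_diff mulr_suml mulr_sumr -big_split; apply: eq_bigr => i _ /=.
by rewrite mderivM mx_evalD !mx_evalM; ring.
Qed.

Lemma mx_diff1 M X : mx_diff (1 : {mpoly K[n * n]}) M X = 0.
Proof.
rewrite /mx_diff big1 // => i _.
by rewrite -mpolyC1 mderivC /mx_eval meval0 mul0r.
Qed.

Definition entry (i j : 'I_n) : {mpoly K[n * n]} := 'X_(mxvec_index i j).

Lemma mx_eval_entry i j M : mx_eval (entry i j) M = M i j.
Proof. by rewrite /mx_eval mevalXU mxvecE. Qed.

Lemma mx_diff_entry i j M X : mx_diff (entry i j) M X = X i j.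
Proof.
rewrite /mx_diff (bigD1 (mxvec_index i j)) //= big1 => [|l neq_l].
  rewrite mderivX mnm1E eqxx scale1r -[X in (X - _)%MM]add0m addmK mpolyX0.
  by rewrite /mx_eval meval1 mul1r addr0 mxvecE.
by rewrite mderivX mnm1E eq_sym (negbTE neq_l) scale0r /mx_eval meval0 mul0r.
Qed.

Lemma mpoly_entry_ind (T : {mpoly K[n * n]} -> Prop) :
  T 0 -> T 1 -> (forall g h, T g -> T h -> T (g + h)) ->
  (forall c g, T g -> T (c *: g)) -> (forall g h, T g -> T h -> T (g * h)) ->
  (forall i j, T (entry i j)) -> forall g, T g.
Proof.
move=> T0 T1 TD TZ TM Tentry; apply: mpolyind => // c m p _ _ Tp.
apply: TD => //; apply: TZ; rewrite mpolyXE_id.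
apply: (big_ind T) => // l _; case/mxvec_indexP: l => i j.
elim: (m _) => [|e IHe]; first by rewrite expr0.
by rewrite exprS; apply: TM => //; apply: Tentry.
Qed.

End Diff.

(** * First-order expansions of rational curves *)

Section Jets.
Variable K : numFieldType.

(** A first-order Taylor expansion at 0, with a remainder that is [t ^+ 2] times
    a rational function without pole at 0.  The expansion is required only away
    from the zeros of [q], so that [f] may have poles outside 0. *)
Definition has_jet (f : K -> K) (a b : K) :=
  exists q r : {poly K}, q.[0] != 0 /\
    forall t, q.[t] != 0 -> f t = a + b * t + t ^+ 2 * (r.[t] / q.[t]).

Lemma eq_has_jet f h a b : f =1 h -> has_jet f a b -> has_jet h a b.
Proof.
by move=> eq_f [q [r [q0 fE]]]; exists q, r; split=> // t /fE <-; rewrite eq_f.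
Qed.

Lemma has_jet_cst c : has_jet (fun=> c) c 0.
Proof.
exists 1, 0; split=> [|t _]; first by rewrite hornerC oner_eq0.
by rewrite horner0 !mul0r mulr0 !addr0.
Qed.

Lemma has_jetD f h a b a' b' : has_jet f a b -> has_jet h a' b' ->
  has_jet (fun t => f t + h t) (a + a') (b + b').
Proof.
move=> [q [r [q0 fE]]] [q' [r' [q'0 hE]]].
exists (q * q'), (r * q' + r' * q); split=> [|t].
  by rewrite hornerM mulf_neq0.
rewrite hornerM mulf_eq0 negb_or => /andP[qt q't].
by rewrite fE // hE // hornerD !hornerM; field; rewrite qt q't.
Qed.

Lemma has_jetM f h a b a' b' : has_jet f a b -> has_jet h a' b' ->
  has_jet (fun t => f t * h t) (a * a') (a * b' + b * a').
Proof.
move=> [q [r [q0 fE]]] [q' [r' [q'0 hE]]].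
exists (q * q'), ((b * b') *: (q * q') + (a%:P + b *: 'X) * r' * q
  + (a'%:P + b' *: 'X) * r * q' + 'X ^+ 2 * r * r').
split=> [|t]; first by rewrite hornerM mulf_neq0.
rewrite hornerM mulf_eq0 negb_or => /andP[qt q't].
rewrite fE // hE // !(hornerD, hornerM, hornerZ, hornerC, hornerX, hornerXn).
by field; rewrite qt q't.
Qed.

Lemma has_jet_sum (I : Type) (s : seq I) (f : I -> K -> K) (a b : I -> K) :
  (forall i, has_jet (f i) (a i) (b i)) ->
  has_jet (fun t => \sum_(i <- s) f i t)
    (\sum_(i <- s) a i) (\sum_(i <- s) b i).
Proof.
move=> jet_f; elim: s => [|i s IHs].
  by rewrite !big_nil; apply: eq_has_jet (has_jet_cst 0) => t; rewrite big_nil.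
rewrite !big_cons; apply: eq_has_jet (has_jetD (jet_f i) IHs) => t.
by rewrite big_cons.
Qed.

Lemma poly_fun_eq0 (p : {poly K}) : (forall t, p.[t] = 0) -> p = 0.
Proof.
move=> p0; apply/eqP/negPn/negP => nz_p.
have := max_poly_roots nz_p (rs := [seq i%:R | i <- iota 0 (size p)]).
rewrite size_map size_iota ltnn => H; suff: false by []; apply: H.
  by apply/allP => x _; apply/rootP.
by rewrite map_inj_uniq ?iota_uniq //; apply: (mulrIn (oner_neq0 K)).
Qed.

(** Clearing the denominator turns the expansion of the zero function into an
    identity between polynomials, since it holds at infinitely many points.  Its
    first two coefficients are [a * q.[0]] and, as [a] is then zero,
    [b * q.[0]]. *)
Lemma has_jet0 a b : has_jet (fun=> 0) a b -> b = 0.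
Proof.
move=> [q [r [q0 fE]]].
have nz_q : q != 0 by apply: contraNneq q0 => ->; rewrite horner0.
(* The last factor [q] absorbs the points where the expansion says nothing. *)
have /eqP : ((a%:P + b *: 'X) * q + 'X ^+ 2 * r) * q = 0.
  apply: poly_fun_eq0 => t; rewrite hornerM.
  have [->|qt] := eqVneq q.[t] 0; first by rewrite mulr0.
  have := congr1 (fun x => x * q.[t]) (fE t qt); rewrite mul0r => E.
  rewrite !(hornerD, hornerM, hornerZ, hornerC, hornerX, hornerXn).
  by rewrite [X in X * _](_ : _ = 0) ?mul0r // [RHS]E; field.
rewrite mulf_eq0 (negbTE nz_q) orbF => /eqP pE.
have a0 : a = 0.
  have /eqP := congr1 (horner^~ 0) pE.
  rewrite !(hornerD, hornerM, hornerZ, hornerC, hornerX, hornerXn).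
  by rewrite !(mulr0, mul0r, addr0) mulf_eq0 (negbTE q0) orbF => /eqP.
have /eqP : 'X * (b *: q + 'X * r) = 0.
  by rewrite -[RHS]pE a0 add0r mulrDr !mulrA -expr2 -scalerAl -scalerAr.
rewrite mulf_eq0 polyX_eq0 => /eqP /(congr1 (horner^~ 0)) /eqP.
rewrite !(hornerD, hornerM, hornerZ, hornerC, hornerX) mul0r addr0.
by rewrite mulf_eq0 (negbTE q0) orbF => /eqP.
Qed.

Definition mx_jet m p (F : K -> 'M[K]_(m, p)) (A B : 'M[K]_(m, p)) :=
  forall i j, has_jet (fun t => F t i j) (A i j) (B i j).

Lemma mx_jet_cst m p (A : 'M[K]_(m, p)) : mx_jet (fun=> A) A 0.
Proof. by move=> i j; rewrite mxE; apply: has_jet_cst. Qed.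

Lemma mx_jet_tr m p F (A B : 'M[K]_(m, p)) :
  mx_jet F A B -> mx_jet (fun t => (F t)^T) A^T B^T.
Proof.
move=> jetF i j; rewrite !mxE.
by apply: eq_has_jet (jetF j i) => t; rewrite mxE.
Qed.

Lemma mx_jetM m p q F (A B : 'M[K]_(m, p)) G (C D : 'M[K]_(p, q)) :
  mx_jet F A B -> mx_jet G C D ->
  mx_jet (fun t => F t *m G t) (A *m C) (A *m D + B *m C).
Proof.
move=> jetF jetG i j; rewrite !mxE -big_split /=.
have /eq_has_jet : has_jet (fun t => \sum_l F t i l * G t l j)
    (\sum_l A i l * C l j) (\sum_l (A i l * D l j + B i l * C l j)).
  by apply: has_jet_sum => l; apply: has_jetM.
by apply=> t; rewrite mxE.
Qed.

(** The chain rule: the expansions form an algebra on which composition with [g]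
    obeys the Leibniz rule, so it is enough to treat the entries. *)
Lemma mx_eval_jet n (g : {mpoly K[n * n]}) F (M X : 'M[K]_n) : mx_jet F M X ->
  has_jet (fun t => mx_eval g (F t)) (mx_eval g M) (mx_diff g M X).
Proof.
move=> jetF; elim/mpoly_entry_ind: g.
- rewrite mx_diff0 /mx_eval meval0.
  by apply: eq_has_jet (has_jet_cst 0) => t; rewrite meval0.
- rewrite mx_diff1 /mx_eval meval1.
  by apply: eq_has_jet (has_jet_cst 1) => t; rewrite meval1.
- move=> g h Jg Jh; rewrite mx_diffD mx_evalD.
  by apply: eq_has_jet (has_jetD Jg Jh) => t; rewrite mx_evalD.
- move=> c g Jg; rewrite mx_diffZ /mx_eval mevalZ.
  have := has_jetM (has_jet_cst c) Jg; rewrite mul0r addr0.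
  by apply: eq_has_jet => t; rewrite /mx_eval mevalZ.
- move=> g h Jg Jh; rewrite mx_diffM mx_evalM addrC.
  by apply: eq_has_jet (has_jetM Jg Jh) => t; rewrite mx_evalM.
- move=> i j; rewrite mx_diff_entry mx_eval_entry.
  by apply: eq_has_jet (jetF i j) => t; rewrite mx_eval_entry.
Qed.

(** Along the curve, a polynomial vanishing on [W] is the zero function, whose
    only first-order expansion is zero. *)
Lemma curve_tangent n (W : classical_sets.set 'M[K]_n) F M X :
  (forall t, W (F t)) -> mx_jet F M X -> tangent_space W M X.
Proof.
move=> WF jetF g Wg; have := mx_eval_jet g jetF.
move=> /(eq_has_jet (h := fun=> 0)) jet0.
by apply: (has_jet0 (jet0 _)) => t; apply: Wg.
Qed.

End Jets.

(** * Critical points of a trace function on the Grassmannian *)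

Section Critical.
Variables (K : numFieldType) (n : nat).
Implicit Types (A P S X : 'M[K]_n).

Lemma pGr_conj k P U : U^T *m U = 1%:M ->
  @pGr K n k P -> @pGr K n k (U *m P *m U^T).
Proof.
move=> UtU [symP idP trP]; split.
- by rewrite /sym_mx /= !trmx_mul trmxK symP mulmxA.
- rewrite !mulmxA -[U *m P *m U^T *m U]mulmxA UtU mulmx1.
  by rewrite -[U *m P *m P]mulmxA idP.
- by rewrite mxtrace_mulC mulmxA UtU mul1mx.
Qed.

(** With [t] the tangent of the half angle, the exponential series of a rotation
    whose generator satisfies [S ^ 3 = - S] becomes rational in [t].  At the
    poles [t ^+ 2 = -1] division by zero yields the identity matrix, so that the
    rotation is orthogonal for all [t]. *)
Definition rotation S (t : K) : 'M[K]_n :=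
  1%:M + (2 * t / (1 + t ^+ 2)) *: S + (2 * t ^+ 2 / (1 + t ^+ 2)) *: (S *m S).

Lemma rotation_orthogonal S t : S^T = - S -> S *m S *m S = - S ->
  (rotation S t)^T *m rotation S t = 1%:M.
Proof.
move=> skewS cubeS; rewrite /rotation.
set a := 2 * t / _; set b := 2 * t ^+ 2 / _.
(* Orthogonality is the vanishing of the coefficient of [S *m S]. *)
have abE : b + b = a ^+ 2 + b ^+ 2.
  rewrite /a /b; have [->|nz] := eqVneq (1 + t ^+ 2) 0.
    by rewrite invr0 !mulr0; ring.
  by field.
set S2 := S *m S.
have -> : (1%:M + a *: S + b *: S2)^T = 1%:M - a *: S + b *: S2.
  rewrite !linearD /= !linearZ /= trmx1 trmx_mul skewS mulNmx mulmxN opprK.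
  by rewrite scalerN.
have S3 : S *m S2 = - S by rewrite mulmxA cubeS.
have S3' : S2 *m S = - S by [].
have S4 : S2 *m S2 = - S2 by rewrite mulmxA S3' mulNmx.
rewrite !mulmxDl !mulmxDr !mul1mx !mulmx1 !mulNmx -!scalemxAl -!scalemxAr.
rewrite S3 S3' S4 -/S2 -!addrA.
rewrite -[RHS]addr0; congr (_ + _).
apply/matrixP => i j; rewrite !mxE.
set x := S i j; set y := \sum_(_ < n) _.
transitivity ((b + b - (a ^+ 2 + b ^+ 2)) * y); first by ring.
by rewrite abE subrr mul0r.
Qed.

Lemma rotation_jet S : mx_jet (rotation S) 1%:M (2 *: S).
Proof.
move=> i j.
exists (1 + 'X^2), ((2 * (S *m S) i j)%:P - (2 * S i j) *: 'X); split=> [|t].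
  by rewrite !(hornerD, hornerC, hornerXn) expr0n addr0 oner_eq0.
rewrite !(hornerD, hornerN, hornerZ, hornerC, hornerX, hornerXn) => wt.
rewrite /rotation !mxE; set x := S i j; set y := \sum_(_ < n) _.
by field.
Qed.

Lemma commutator_tangent k P S :
  S^T = - S -> S *m S *m S = - S -> @pGr K n k P ->
  tangent_space (@pGr K n k) P (2 *: (S *m P - P *m S)).
Proof.
move=> skewS cubeS grP.
apply: (@curve_tangent _ _ _ (fun t => rotation S t *m P *m (rotation S t)^T)).
  by move=> t; apply: pGr_conj => //; apply: rotation_orthogonal.
have jetU := rotation_jet S.
have := mx_jetM (mx_jetM jetU (mx_jet_cst P)) (mx_jet_tr jetU).
rewrite trmx1 mul1mx !mulmx1 mulmx0 add0r linearZ /= skewS addrC.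
by rewrite -scalemxAr -scalemxAl mulmxN -scalerDr.
Qed.

(** The equation [P *m P = P], differentiated entry by entry. *)
Lemma tangent_pGr_idem k P X : @pGr K n k P -> tangent_space (@pGr K n k) P X ->
  X *m P + P *m X = X.
Proof.
move=> grP tanX; apply/matrixP => i j.
pose g : {mpoly K[n * n]} :=
  \sum_l entry K i l * entry K l j - entry K i j.
have g0 : vanishing_ideal (@pGr K n k) g.
  move=> M [_ idM _]; rewrite mx_evalB mx_eval_sum mx_eval_entry -{2}idM mxE.
  apply/eqP; rewrite subr_eq0; apply/eqP; apply: eq_bigr => l _.
  by rewrite mx_evalM !mx_eval_entry.
have := tanX g g0; rewrite mx_diffB mx_diff_sum mx_diff_entry => /eqP.
rewrite subr_eq0 => /eqP <-; rewrite !mxE -big_split; apply: eq_bigr => l _ /=.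
by rewrite mx_diffM !mx_diff_entry !mx_eval_entry.
Qed.

Definition trace_poly A : {mpoly K[n * n]} :=
  \sum_i \sum_j A i j *: entry K j i.

Lemma mx_eval_trace_poly A M : mx_eval (trace_poly A) M = \tr (A *m M).
Proof.
rewrite mx_eval_sum; apply: eq_bigr => i _; rewrite mx_eval_sum mxE.
apply: eq_bigr => j _.
by rewrite /mx_eval mevalZ -[meval _ _]/(mx_eval _ _) mx_eval_entry.
Qed.

Lemma mx_diff_trace_poly A M X : mx_diff (trace_poly A) M X = \tr (A *m X).
Proof.
rewrite mx_diff_sum; apply: eq_bigr => i _; rewrite mx_diff_sum mxE.
by apply: eq_bigr => j _; rewrite mx_diffZ mx_diff_entry.
Qed.

(** Two polynomials inducing the same function on [W] differ by an element of
    the ideal of [W], so that the linear polynomial may stand for all of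
    them. *)
Lemma critical_traceP (W : classical_sets.set 'M[K]_n) A P :
  critical_points W (fun M => \tr (A *m M)) P <->
  W P /\ (forall X, tangent_space W P X -> \tr (A *m X) = 0).
Proof.
split=> [[WP [F [FE dF0]]]|[WP tr0]]; split=> //.
  move=> X tanX; rewrite -(mx_diff_trace_poly A P X).
  have : vanishing_ideal W (trace_poly A - F).
    by move=> M WM; rewrite mx_evalB mx_eval_trace_poly FE // subrr.
  by move/tanX; rewrite mx_diffB dF0 // subr0.
exists (trace_poly A); split=> [M _|X tanX]; first exact: mx_eval_trace_poly.
by rewrite mx_diff_trace_poly tr0.
Qed.

(** Rotations of the coordinate planes already suffice, as their generators span
    the skew-symmetric matrices. *)
Lemma skew_delta (i j : 'I_n) (S := delta_mx i j - delta_mx j i : 'M[K]_n) :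
  S^T = - S /\ S *m S *m S = - S.
Proof.
rewrite /S linearB /= !trmx_delta opprB; split=> //.
have [<-|nij] := eqVneq i j; first by rewrite subrr !mul0mx.
rewrite !(mulmxBl, mulmxBr) !mul_delta_mx_cond.
rewrite !eqxx [j == i]eq_sym (negbTE nij).
rewrite !mulr0n !mulr1n !(mul0mx, subr0, sub0r).
rewrite !mul_delta_mx_cond !eqxx [j == i]eq_sym (negbTE nij).
by rewrite !mulr0n !mulr1n oppr0 addr0 sub0r opprK addrC.
Qed.

Lemma tr_mul_delta (M : 'M[K]_n) i j : \tr (M *m delta_mx i j) = M j i.
Proof.
rewrite /mxtrace (bigD1 j) //= [X in _ + X]big1 => [|l nlj]; rewrite !mxE.
  rewrite (bigD1 i) //= big1 => [|l nli]; rewrite !mxE ?eqxx ?mulr1 ?addr0 //.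
  by rewrite (negbTE nli) mulr0.
by rewrite big1 // => m _; rewrite !mxE (negbTE nlj) andbF mulr0.
Qed.

(** A critical [P] commutes with [A] because the skew-symmetric matrix
    [P *m A - A *m P] pairs to zero with every infinitesimal rotation.  If
    conversely [P] commutes with [A], then in [X = X *m P + P *m X] both terms
    contribute [\tr (A *m P *m X *m P)], and [P *m X *m P] vanishes. *)
Lemma critical_pGrP k A P : A^T = A ->
  critical_points (@pGr K n k) (fun M => \tr (A *m M)) P <->
  @pGr K n k P /\ A *m P = P *m A.
Proof.
move=> symA; rewrite critical_traceP; split=> -[grP H];
  split=> //; last first.
  move=> X /(tangent_pGr_idem grP) XE.
  have [_ idP _] := grP.
  have PXP : P *m X *m P = 0.
    have := congr1 (fun Y => P *m Y *m P) XE.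
    rewrite mulmxDr mulmxDl !mulmxA idP -[_ *m P *m P]mulmxA idP => /eqP.
    by rewrite -subr_eq0 addrK => /eqP.
  rewrite -XE mulmxDr mxtraceD.
  have -> : A *m (X *m P) = A *m X *m P *m P by rewrite -!mulmxA idP.
  have -> : A *m (P *m X) = A *m P *m P *m X.
    by rewrite -!mulmxA [P *m (P *m X)]mulmxA idP.
  rewrite mxtrace_mulC !mulmxA -H [X in _ + \tr (X *m _ *m _)]H.
  rewrite -[in X in _ + X]mulmxA -[in X in _ + X]mulmxA.
  rewrite [X in _ + X]mxtrace_mulC.
  by rewrite -!mulmxA [P *m (X *m P)]mulmxA PXP mulmx0 mxtrace0 addr0.
have [symP _ _] := grP.
set C := P *m A - A *m P.
have skewC : C^T = - C by rewrite linearB /= !trmx_mul symA symP opprB.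
suff C0 : C = 0 by apply/eqP; rewrite eq_sym -subr_eq0; apply/eqP.
apply/matrixP => i j; rewrite [RHS]mxE.
have [skS cbS] := skew_delta j i.
have := H _ (commutator_tangent skS cbS grP).
set S := delta_mx j i - _ => trS.
have : \tr (C *m S) = 0.
  move: trS; rewrite -scalemxAr mxtraceZ => /eqP; rewrite mulf_eq0 pnatr_eq0 /=.
  rewrite mulmxBr linearB /= !mulmxA [\tr (A *m S *m P)]mxtrace_mulC mulmxA.
  by rewrite -linearB /= -mulmxBl => /eqP.
rewrite mulmxBr linearB /= !tr_mul_delta.
have -> : C j i = - C i j.
  have := congr1 (fun M : 'M[K]_n => M i j) skewC.
  by rewrite /= [C^T i j]mxE [(- C) i j]mxE.
by rewrite opprK -mulr2n => /eqP; rewrite mulrn_eq0 => /eqP.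
Qed.

End Critical.

(** * Subspaces and the projections that represent them *)

Section Represents.
Variables (K : fieldType) (n k : nat).
Implicit Types (L : {vspace 'cV[K]_n}) (P : 'M[K]_n) (Z : 'M[K]_(n, k)).

Let col_tuple Z : k.-tuple 'cV[K]_n := [tuple col j Z | j < k].

Lemma mul_cols Z (c : 'cV[K]_k) : Z *m c = \sum_j c j 0 *: col j Z.
Proof.
apply/colP => i; rewrite mxE summxE; apply: eq_bigr => j _.
by rewrite !mxE mulrC.
Qed.

Lemma cols_free Z : Z^T *m Z = 1%:M -> free [seq col j Z | j <- enum 'I_k].
Proof.
move=> ZtZ; change (is_true (free (col_tuple Z))).
apply/freeP => c c0 j.
have : Z *m \col_j c j = 0.
  rewrite mul_cols -[RHS]c0; apply: eq_bigr => l _.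
  by rewrite mxE (nth_map l) ?size_enum_ord // nth_ord_enum.
move/(congr1 (mulmx Z^T)); rewrite mulmxA ZtZ mul1mx mulmx0.
by move/colP/(_ j); rewrite !mxE.
Qed.

Lemma represents_dim L P : represents k L P -> \dim L = k.
Proof.
move=> [Z [/cols_free freeZ -> _]].
by move/eqP: freeZ => ->; rewrite size_map size_enum_ord.
Qed.

(** The projection [Z *m Z^T] fixes the columns of [Z], which span its image. *)
Lemma represents_mem L P v : represents k L P -> (v \in L) = (P *m v == v).
Proof.
move=> [Z [ZtZ -> ->]]; apply/idP/eqP => [|<-].
  move/(coord_span (X := col_tuple Z)) => ->.
  rewrite mulmx_sumr; apply: eq_bigr => j _.
  rewrite -scalemxAr; congr (_ *: _).
  rewrite (nth_map j) ?size_enum_ord // nth_ord_enum.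
  by rewrite colE !mulmxA -[Z *m Z^T *m Z]mulmxA ZtZ mulmx1.
rewrite -mulmxA mul_cols; apply: memv_suml => j _.
by apply: memvZ; apply: memv_span; apply: map_f; rewrite mem_enum.
Qed.

Lemma represents_pGr L P : represents k L P -> @pGr K n k P.
Proof.
move=> [Z [ZtZ _ ->]]; split.
- by rewrite /sym_mx /= trmx_mul trmxK.
- by rewrite !mulmxA -[Z *m Z^T *m Z]mulmxA ZtZ mulmx1.
- by rewrite mxtrace_mulC ZtZ mxtrace1.
Qed.

Lemma eq_col_mulmx (M N P : 'M[K]_n) :
  (forall j, P *m col j M = col j N) -> P *m M = N.
Proof.
move=> H; apply/matrixP => i j; have /colP/(_ i) := H j.
by rewrite colE mulmxA -colE !mxE.
Qed.

(** Two symmetric projections with the same fixed space absorb each other on the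
    left, and by transposition on the right. *)
Lemma represents_inj L P P' : represents k L P -> represents k L P' -> P = P'.
Proof.
have absorb M N : represents k L M -> represents k L N -> M *m N = N.
  move=> LM LN; have [_ idN _] := represents_pGr LN.
  apply: eq_col_mulmx => j; apply/eqP; rewrite -(represents_mem _ LM).
  by rewrite (represents_mem _ LN) colE mulmxA idN.
move=> LP LP'; have [symP _ _] := represents_pGr LP.
have [symP' _ _] := represents_pGr LP'.
rewrite -(absorb _ _ LP' LP) -[P' in LHS]symP' -[P in LHS]symP.
by rewrite -trmx_mul absorb // symP'.
Qed.

(** A space spanned by eigenvectors is stable under [A], which says that
    [P *m A *m P = A *m P]; the left-hand side being symmetric, so is
    [A *m P]. *)
Lemma spanned_by_eigenvectors_commute A L P : A^T = A ->
  spanned_by_eigenvectors k A L -> represents k L P -> A *m P = P *m A.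
Proof.
move=> symA [_ [vs [eig_vs LE]]] LP.
have stableL v : v \in L -> A *m v \in L.
  rewrite LE => /coord_span ->; rewrite mulmx_sumr; apply: memv_suml => j _.
  rewrite -scalemxAr; apply: memvZ.
  have vsj : vs`_j \in vs by rewrite mem_nth ?size_tuple.
  have [_ [a ->]] := eig_vs _ vsj; exact/memvZ/memv_span.
have [symP idP _] := represents_pGr LP.
have PAP : P *m (A *m P) = A *m P.
  apply: eq_col_mulmx => j; apply/eqP; rewrite -(represents_mem _ LP).
  rewrite colE -mulmxA; apply: stableL; rewrite (represents_mem _ LP).
  by rewrite mulmxA idP.
by rewrite -PAP; have := congr1 trmx PAP; rewrite !trmx_mul symP symA -mulmxA.
Qed.

End Represents.

(** * Projections commuting with a matrix that has an orthonormal eigenbasis *)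

Section OrthonormalEigenbasis.
Variables (K : numFieldType) (n : nat) (A Q : 'M[K]_n) (d : 'rV[K]_n).
Hypotheses (QtQ : Q^T *m Q = 1%:M) (AQ : A *m Q = Q *m diag_mx d).
Hypothesis inj_d : injective (d 0).
Implicit Type I : {set 'I_n}.

Let QQt : Q *m Q^T = 1%:M := mulmx1C QtQ.

Let QtA : Q^T *m A = diag_mx d *m Q^T.
Proof.
rewrite -[LHS]mulmx1 -QQt !mulmxA -[Q^T *m A *m Q]mulmxA AQ.
by rewrite mulmxA QtQ mul1mx.
Qed.

Definition spectral_proj I : 'M[K]_n :=
  Q *m diag_mx (\row_i (i \in I)%:R) *m Q^T.

Lemma spectral_proj_inj : injective spectral_proj.
Proof.
move=> I J /(congr1 (fun M => Q^T *m M *m Q)).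
rewrite /spectral_proj !mulmxA QtQ !mul1mx -!mulmxA QtQ !mulmx1 => IJ.
apply/setP => i; have /matrixP/(_ i i) := IJ.
rewrite !mxE eqxx !mulr1n => /eqP; case: (i \in I) (i \in J) => [] [];
  by rewrite ?eqxx // ?oner_eq0 // eq_sym oner_eq0.
Qed.

(** In the eigenbasis, commuting with the diagonal matrix of distinct
    eigenvalues forces the projection to be diagonal; its entries are then 0 or
    1, and the trace counts the entries 1 because the characteristic is 0. *)
Lemma commuting_projP k P : @pGr K n k P -> A *m P = P *m A ->
  exists I, #|I| = k /\ P = spectral_proj I.
Proof.
move=> [_ idP trP] comAP.
pose E := Q^T *m P *m Q.
have PE : P = Q *m E *m Q^T.
  by rewrite /E !mulmxA QQt mul1mx -mulmxA QQt mulmx1.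
have idE : E *m E = E.
  rewrite /E !mulmxA -[_ *m Q *m Q^T]mulmxA QQt mulmx1.
  by rewrite -[_ *m P *m P]mulmxA idP.
have trE : \tr E = k%:R by rewrite mxtrace_mulC mulmxA QQt mul1mx.
have comE : diag_mx d *m E = E *m diag_mx d.
  by rewrite /E !mulmxA -QtA -[_ *m A *m P]mulmxA comAP -!mulmxA AQ.
clearbody E; have diagE i j : i != j -> E i j = 0.
  move=> nij; have /matrixP/(_ i j) := comE.
  rewrite mul_diag_mx mul_mx_diag !mxE mulrC => /eqP.
  rewrite -subr_eq0 -mulrBr mulf_eq0 subr_eq0 (inj_eq inj_d) (negbTE nij) orbF.
  by move/eqP.
pose I := [set i | E i i != 0].
have EI : E = diag_mx (\row_i (i \in I)%:R).
  apply/matrixP => i j; rewrite !mxE.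
  have [<-|/diagE ->] := eqVneq i j; last by rewrite mulr0n.
  rewrite mulr1n inE; have /matrixP/(_ i i) := idE.
  rewrite mxE (bigD1 i) //= big1 => [|l nli]; last first.
    by rewrite diagE ?mul0r // eq_sym.
  have [->//|nz] := eqVneq (E i i) 0.
  by rewrite addr0 -[RHS]mulr1 => /(mulfI nz).
exists I; split; last by rewrite /spectral_proj -EI.
apply/eqP; rewrite -(eqr_nat K) -trE {1}EI mxtrace_diag -sum1_card natr_sum.
rewrite big_mkcond /=; apply/eqP; apply: eq_bigr => i _.
by rewrite mxE; case: (i \in I).
Qed.

Lemma cols_orthonormal k (s : 'I_k -> 'I_n) : injective s ->
  (colsub s Q)^T *m colsub s Q = 1%:M.
Proof.
move=> inj_s; apply/matrixP => i j.
have /matrixP/(_ (s i) (s j)) := QtQ; rewrite !mxE (inj_eq inj_s) => <-.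
by apply: eq_bigr => l _; rewrite !mxE.
Qed.

Lemma cols_spectral_proj k (s : 'I_k -> 'I_n) : injective s ->
  colsub s Q *m (colsub s Q)^T = spectral_proj [set s j | j : 'I_k].
Proof.
move=> inj_s; apply/matrixP => i j; rewrite !mxE.
under [RHS]eq_bigr do rewrite mul_mx_diag !mxE.
rewrite (bigID (mem [set s j | j : 'I_k])) /= [X in _ + X]big1 ?addr0 => [|l].
  rewrite big_imset /=; last by move=> ? ? _ _ /inj_s.
  apply: eq_bigr => l _; rewrite !mxE imset_f ?mulr1 //.
by move/negbTE=> ->; rewrite mulr0 mul0r.
Qed.

Lemma eigenvector_col j : eigenvector A (col j Q).
Proof.
split; last first.
  exists (d 0 j); apply/colP => i; have /matrixP/(_ i j) := AQ.
  rewrite mul_mx_diag !mxE mulrC => <-; apply: eq_bigr => l _.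
  by rewrite mxE.
apply/eqP => /(congr1 (mulmx Q^T)); rewrite colE mulmxA QtQ mul1mx mulmx0.
by move/colP/(_ j)/eqP; rewrite !mxE !eqxx oner_eq0.
Qed.

(** The coordinates of an eigenvector satisfy [(d i - a) * w i = 0], so only one
    of them is nonzero, the eigenvalues being distinct. *)
Lemma eigenvectorP v : eigenvector A v -> exists j c, v = c *: col j Q.
Proof.
move=> [nz_v [a Av]]; pose w := Q^T *m v.
have vE : v = Q *m w by rewrite mulmxA QQt mul1mx.
have Dw : diag_mx d *m w = a *: w.
  by rewrite mulmxA -QtA -mulmxA Av -scalemxAr.
have wE j : (d 0 j - a) * w j 0 = 0.
  have /colP/(_ j) := Dw; rewrite mul_diag_mx !mxE mulrBl => ->.
  by rewrite subrr.
have [i nz_wi] : exists i, w i 0 != 0.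
  apply/existsP; apply: contraNT nz_v => /existsPn w0; rewrite vE.
  suff -> : w = 0 by rewrite mulmx0.
  by apply/colP => i; rewrite [RHS]mxE; have /negPn/eqP := w0 i.
exists i, (w i 0); rewrite {1}vE mul_cols (bigD1 i) //= big1 ?addr0 // => j nji.
have /eqP := wE j; have /eqP := wE i; rewrite !mulf_eq0 (negbTE nz_wi) orbF.
rewrite !subr_eq0 => /eqP <-; rewrite (inj_eq inj_d) (negbTE nji) => /eqP ->.
by rewrite scale0r.
Qed.

Lemma span_cols_represents k (s : 'I_k -> 'I_n) : injective s ->
  represents k <<[seq col (s j) Q | j <- enum 'I_k]>>
    (spectral_proj [set s j | j : 'I_k]).
Proof.
move=> inj_s; exists (colsub s Q).
rewrite cols_orthonormal // cols_spectral_proj //.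
split=> //; congr <<_>>%VS; apply: eq_map => j.
by apply/colP => i; rewrite !mxE.
Qed.

Lemma spectral_proj_represents I : exists L,
  spanned_by_eigenvectors #|I| A L /\ represents #|I| L (spectral_proj I).
Proof.
have LI := span_cols_represents (@enum_val_inj _ I).
exists <<[seq col (enum_val j) Q | j <- enum 'I_#|I|]>>%VS; split.
  split; first exact: represents_dim LI.
  exists [tuple col (enum_val j) Q | j < #|I|]; split=> // v /mapP[j _ ->].
  exact: eigenvector_col.
rewrite (_ : [set enum_val j | j : 'I_#|I|] = I) // in LI *.
apply/setP => i; apply/imsetP/idP => [[j _ ->]|iI]; first exact: enum_valP.
by exists (enum_rank_in iI i) => //; rewrite enum_rankK_in.
Qed.

(** Each of the [k] spanning eigenvectors is a multiple of a column of [Q].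
    These columns span a space of dimension [k], so no column is repeated. *)
Lemma spanned_by_eigenvectors_represents k L :
  spanned_by_eigenvectors k A L -> exists P, represents k L P.
Proof.
move=> [dimL [vs [eig_vs LE]]].
have /fin_all_exists[s sP] j : exists i, exists c, tnth vs j = c *: col i Q.
  by apply: eigenvectorP; apply: eig_vs; apply: mem_tnth.
pose cs := [seq col (s j) Q | j <- enum 'I_k].
have subL : (L <= <<cs>>)%VS.
  rewrite LE; apply/span_subvP => _ /tnthP[j ->]; have [c ->] := sP j.
  by apply: memvZ; apply: memv_span; apply: map_f; rewrite mem_enum.
have sz_cs : size cs = k by rewrite size_map size_enum_ord.
have dim_cs : \dim <<cs>> = k.
  apply/eqP; rewrite eqn_leq; apply/andP; split.
    by rewrite -[X in (_ <= X)%N]sz_cs dim_span.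
  by rewrite -[X in (X <= _)%N]dimL dimvS.
have inj_s : injective s.
  have /free_uniq/injectiveP inj_cols : free cs by rewrite /free dim_cs sz_cs.
  by move=> j l eq_s; apply: inj_cols; rewrite eq_s.
have -> : L = <<cs>>%VS by apply/eqP; rewrite eqEdim subL dim_cs dimL leqnn.
by eexists; apply: span_cols_represents.
Qed.

End OrthonormalEigenbasis.

(** * Symmetric matrices with a separable characteristic polynomial *)

Section Separability.
Variables (F : fieldType) (n : nat).
Implicit Types A P : 'M[F]_n.+1.

Lemma horner_mx_eigen A x (v : 'rV[F]_n.+1) p :
  v *m A = x *: v -> v *m horner_mx A p = p.[x] *: v.
Proof.
move=> vA; elim/poly_ind: p => [|p c IHp].
  by rewrite rmorph0 mulmx0 horner0 scale0r.
rewrite rmorphD rmorphM /= horner_mx_X horner_mx_C mulmxDr mulmxA IHp.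
rewrite -scalemxAl vA mul_mx_scalar scalerA -scalerDl.
by rewrite hornerD hornerM hornerX hornerC.
Qed.

(** By Cayley-Hamilton, a Bezout relation between the characteristic polynomial
    and its derivative exhibits an inverse of the derivative evaluated at
    [A]. *)
Lemma separable_det_neq0 A : separable_poly (char_poly A) ->
  \det (horner_mx A (char_poly A)^`()) != 0.
Proof.
rewrite unlock => /Bezout_eq1_coprimepP[[u v] /= /(congr1 (horner_mx A))].
rewrite rmorphD !rmorphM rmorph1 /= Cayley_Hamilton mulr0 add0r.
move=> /mulmx1_unit[_].
by rewrite unitmxE unitfE.
Qed.

Lemma char_poly_similar A D P :
  P \in unitmx -> P *m A = D *m P -> char_poly A = char_poly D.
Proof.
move=> uP PA; pose P' := map_mx polyC P.
have : P' *m char_poly_mx A = char_poly_mx D *m P'.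
  by rewrite mulmxBr mulmxBl -!map_mxM PA mul_mx_scalar mul_scalar_mx.
move/(congr1 determinant); rewrite !det_mulmx [RHS]mulrC.
by apply: mulfI; rewrite det_map_mx polyC_eq0 -unitfE -unitmxE.
Qed.

End Separability.

Section ClosedField.
Variables (C : numClosedFieldType) (n : nat).
Implicit Types A : 'M[C]_n.+1.

(** At a double root, an eigenvector lies in the kernel of the derivative
    evaluated at [A]. *)
Lemma det_neq0_separable A : \det (horner_mx A (char_poly A)^`()) != 0 ->
  separable_poly (char_poly A).
Proof.
move=> det_n0; rewrite unlock; apply/Pdiv.ClosedField.coprimepP => x.
rewrite -eigenvalue_root_char => /eigenvalueP[v vA nz_v].
apply: contraNneq det_n0 => px0; apply/det0P; exists v => //.
by rewrite (horner_mx_eigen _ vA) px0 scale0r.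
Qed.

Lemma separable_diagonalizable A : separable_poly (char_poly A) ->
  exists (P : 'M[C]_n.+1) (d : 'rV[C]_n.+1),
    [/\ P \in unitmx, P *m A = diag_mx d *m P & injective (d 0)].
Proof.
have [r charE] := closed_field_poly_normal (char_poly A).
rewrite (monicP (char_poly_monic A)) scale1r in charE.
move=> sepA.
have [P uP /similar_diagPex[d /(similarP uP) PA]] : diagonalizable A.
  apply/diagonalizableP; exists r; last by rewrite -charE mxminpoly_dvd_char.
  by rewrite -separable_prod_XsubC -charE.
exists P, d; split=> //.
move: sepA; rewrite (char_poly_similar uP PA).
rewrite char_poly_trig ?diag_mx_is_trig //.
rewrite -(big_map (fun i => diag_mx d i i) xpredT (fun a => 'X - a%:P)).
rewrite separable_prod_XsubC /index_enum -enumT => /injectiveP inj_d i j dij.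
by apply: inj_d; rewrite !mxE !eqxx.
Qed.

(** The Gram matrix [G] of an eigenbasis for the form [x^T y] commutes with the
    diagonal matrix of eigenvalues, hence is diagonal; it is also invertible, so
    that its diagonal entries are nonzero and the basis can be normalised. *)
Lemma orthonormal_eigenbasis A : A^T = A -> separable_poly (char_poly A) ->
  exists (Q : 'M[C]_n.+1) (d : 'rV[C]_n.+1),
    [/\ Q^T *m Q = 1%:M, A *m Q = Q *m diag_mx d & injective (d 0)].
Proof.
move=> symA /separable_diagonalizable[P [d [uP PA inj_d]]].
pose G := P *m P^T.
have comG : diag_mx d *m G = G *m diag_mx d.
  rewrite /G mulmxA -PA -!mulmxA; congr (_ *m _).
  by have := congr1 trmx PA; rewrite !trmx_mul symA tr_diag_mx.
pose e := \row_i G i i.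
have GE : G = diag_mx e.
  apply/matrixP => i j; rewrite [RHS]mxE [X in X *+ _]mxE.
  have [<-|nij] := eqVneq i j; first by rewrite mulr1n.
  have /matrixP/(_ i j) := comG; clearbody G.
  rewrite mul_diag_mx mul_mx_diag !mxE mulrC => /eqP.
  rewrite -subr_eq0 -mulrBr mulf_eq0 subr_eq0 (inj_eq inj_d) (negbTE nij) orbF.
  by move/eqP.
have nz_e i : G i i != 0.
  have : \det G != 0 by rewrite -unitfE -unitmxE unitmx_mul unitmx_tr uP.
  rewrite {1}GE det_diag; apply: contraNneq => e0.
  by rewrite (bigD1 i) //= mxE e0 mul0r.
pose s := \row_i (sqrtC (G i i))^-1.
exists (P^T *m diag_mx s), d; split=> //.
  rewrite trmx_mul trmxK tr_diag_mx mulmxA -[_ *m P *m P^T]mulmxA -/G GE.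
  clearbody G; rewrite !mulmx_diag; apply/matrixP => i j; rewrite !mxE.
  case: eqVneq => // _; rewrite !mulr1n.
  rewrite -[X in _ * X * _]sqrtCK expr2.
  by rewrite mulrA mulVf ?mul1r ?mulfV // sqrtC_eq0 nz_e.
have AP : A *m P^T = P^T *m diag_mx d.
  by have := congr1 trmx PA; rewrite !trmx_mul symA tr_diag_mx.
by rewrite mulmxA AP -!mulmxA diag_mxC.
Qed.

End ClosedField.

Section Discriminant.
Variables (F : numFieldType) (n : nat).

(** Up to sign this is the discriminant of the characteristic polynomial [p] of
    the generic matrix: the determinant of [p'(A)] is the product of the
    values of [p'] at the eigenvalues of [A]. *)
Definition discriminant_poly : {mpoly F[n.+1 * n.+1]} :=
  let G := \matrix_(i, j) entry F i j in
  \det (horner_mx G (char_poly G)^`()).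

Lemma mx_eval_discriminant (A : 'M[F]_n.+1) :
  mx_eval discriminant_poly A = \det (horner_mx A (char_poly A)^`()).
Proof.
rewrite /mx_eval /discriminant_poly -det_map_mx map_horner_mx -deriv_map.
rewrite map_char_poly.
set B := map_mx _ _; suff -> : B = A by [].
by apply/matrixP => i j; rewrite !mxE -[LHS]/(mx_eval _ _) mx_eval_entry.
Qed.

Lemma discriminant_generic (T : 'M[F]_n.+1 -> Prop) :
  (forall A, sym_mx A -> \det (horner_mx A (char_poly A)^`()) != 0 -> T A) ->
  holds_generically_sym T.
Proof.
move=> TA.
exists [set A | sym_mx A /\ mx_eval discriminant_poly A = 0]%classic; split.
- exists [set discriminant_poly]%classic; apply/seteqP; split=> A /= [symA dA].
    by split=> // g ->.
  by split=> //; apply: dA.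
- split=> [A []//|]; pose D : 'M[F]_n.+1 := diag_mx (\row_i (i : nat)%:R).
  have symD : sym_mx D by rewrite /sym_mx /= tr_diag_mx.
  move=> /(_ D symD) [_] /eqP; apply/negP; rewrite mx_eval_discriminant.
  apply: separable_det_neq0; rewrite char_poly_trig ?diag_mx_is_trig //.
  rewrite -(big_map (fun i => D i i) xpredT (fun a => 'X - a%:P)).
  rewrite separable_prod_XsubC /index_enum -enumT; apply/injectiveP => i j.
  by rewrite !mxE !eqxx !mulr1n => /(mulrIn (oner_neq0 F))/val_inj.
move=> A symA nZA; apply: TA => //.
by rewrite -mx_eval_discriminant; apply/eqP => dA; apply: nZA.
Qed.

End Discriminant.

(** * The multi-eigenvector problem *)

Section MultiEigenvector.
Variables (C : numClosedFieldType) (n k : nat) (A : 'M[C]_n.+1).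
Hypotheses (symA : A^T = A) (sepA : separable_poly (char_poly A)).

Let crit := critical_points (@pGr C n.+1 k) (fun P => \tr (A *m P)).

Lemma critical_representsP P : crit P <->
  exists L : {vspace 'cV[C]_n.+1},
    spanned_by_eigenvectors k A L /\ represents k L P.
Proof.
have [Q [d [QtQ AQ inj_d]]] := orthonormal_eigenbasis symA sepA.
rewrite /crit critical_pGrP //; split=> [[grP comP]|[L [eigL LP]]].
  have [I [<- ->]] := commuting_projP QtQ AQ inj_d grP comP.
  exact: spectral_proj_represents QtQ AQ I.
split; first exact: represents_pGr LP.
exact: spanned_by_eigenvectors_commute eigL LP.
Qed.

Lemma critical_card : (crit #= `I_('C(n.+1, k)))%card.
Proof.
have [Q [d [QtQ AQ inj_d]]] := orthonormal_eigenbasis symA sepA.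
pose D := [set I : {set 'I_n.+1} | #|I| == k]%SET.
pose f (i : 'I_#|D|) := spectral_proj Q (enum_val i).
have -> : crit = (f @` setT)%classic.
  apply/seteqP; split=> P /=.
    rewrite /crit critical_pGrP // => -[grP comP].
    have [I [cardI ->]] := commuting_projP QtQ AQ inj_d grP comP.
    have DI : I \in D by rewrite inE cardI.
    by exists (enum_rank_in DI I) => //; rewrite /f enum_rankK_in.
  move=> [i _ <-]; apply/critical_representsP; have := enum_valP i.
  rewrite inE => /eqP <-; exact: spectral_proj_represents QtQ AQ _.
have inj_f : injective f by move=> i j /(spectral_proj_inj QtQ)/enum_val_inj.
have <- : #|D| = 'C(n.+1, k) by rewrite card_draws card_ord.
apply: card_eq_trans (inj_card_eq _) _; first by move=> i j _ _; apply: inj_f.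
by rewrite card_eq_sym card_II.
Qed.

Lemma unique_represents L : spanned_by_eigenvectors k A L ->
  exists! P, represents k L P.
Proof.
move=> eigL; have [Q [d [QtQ AQ inj_d]]] := orthonormal_eigenbasis symA sepA.
have [P LP] := spanned_by_eigenvectors_represents QtQ AQ inj_d eigL.
by exists P; split=> // P'; apply: represents_inj.
Qed.

End MultiEigenvector.

Theorem theorem3p3 (R : realType) (n k : nat) (k_gt0 : (1 <= k)%N)
    (k_le_n : (k <= n)%N) :
  holds_generically_sym (fun A : 'M[R]_n =>
    let AC : 'M[R[i]]_n := map_mx (real_complex R) A in
    let crit : set 'M[R[i]]_n :=
      critical_points (pGr k) (fun P : 'M[R[i]]_n => \tr (AC *m P)) in
    [/\ (crit #= `I_('C(n, k)))%card,
        forall P : 'M[R[i]]_n, crit P <->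
          exists L : {vspace 'cV[R[i]]_n},
            spanned_by_eigenvectors k AC L /\ represents k L P
      & forall L : {vspace 'cV[R[i]]_n},
          spanned_by_eigenvectors k AC L ->
          exists! P : 'M[R[i]]_n, represents k L P]).
Proof.
case: n => [|n] in k_le_n *; first by rewrite leqNgt k_gt0 in k_le_n.
apply: discriminant_generic => A symA det_n0 AC crit.
have symAC : AC^T = AC by rewrite /AC map_trmx symA.
have sepAC : separable_poly (char_poly AC).
  apply: det_neq0_separable.
  by rewrite /AC -map_char_poly deriv_map -map_horner_mx det_map_mx fmorph_eq0.
split.
- exact: (@critical_card R[i] n k AC symAC sepAC).
- exact: (@critical_representsP R[i] n k AC symAC sepAC).
- exact: (@unique_represents R[i] n k AC symAC sepAC).
Qed.
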